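(* Let $(X,d)$ be a forwards continuous asymmetric metric space satisfying the following property: ( * ) if $\{x_m\}_{m\ge 1}\subset X$ is a forwards admissible sequence that has a closest forward limit $x\in X$, then $\{x_m\}$ is also backwards admissible and $x$ is its closest backward limit. Let $(\hat X,\hat d)$ be the forwards completion of $X$, with canonical isometric embedding $\iota\colon X\to\hat X$. Then each isometry $f\colon X\to X$ induces a unique isometry $F\colon\hat X\to\hat X$, i.e. there is a unique isometry $F$ of $\hat X$ with $F\circ\iota=\iota\circ f$.
   Context: An asymmetric metric on a set $X$ is a function $d\colon X\times X\to[0,\infty]$ such that $d(x,x)=0$; $d(x,y)=d(y,x)=0$ implies $x=y$; and $d(x,z)\le d(x,y)+d(y,z)$. An isometry is a bijection preserving $d$ (as an ordered-pair function). A point $x$ is the closest forward limit (CFL) of $\{x_m\}$ if $\lim_m d(x_m,x)=0$ and $d(x,y)=0$ for every $y$ with $\lim_m d(x_m,y)=0$. The closest backward limit is defined by switching the order of the arguments of $d$: $\lim_m d(x,x_m)=0$, and $d(y,x)=0$ whenever $\lim_m d(y,x_m)=0$. $\{x_m\}$ is forwards admissible if for every $\varepsilon>0$ there is $N(\varepsilon)$ such that for every $m>N(\varepsilon)$ there is $K(m,\varepsilon)>m$ with $d(x_m,x_k)<\varepsilon$ for all $k>K(m,\varepsilon)$; backwards admissible is the same with $d(x_k,x_m)<\varepsilon$. $(X,d)$ is forwards continuous if for every forwards admissible $\{x_m\}$ with CFL $x$ and every $y\in X$: $d(x,y)=\lim_m d(x_m,y)$ and $d(y,x)=\lim_m d(y,x_m)$.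 For forwards admissible $\xi=\{x_m\}$, $\eta=\{y_k\}$ put $c(\xi,\eta)=\lim_{m\to\infty}\lim_{k\to\infty}d(x_m,y_k)\in[0,\infty]$ (this always exists). $\xi$ and $\eta$ are neighbors if the interlaced sequence $x_1,y_1,x_2,y_2,\dots$ is forwards admissible. They are equivalent if they are neighbors or have the same CFL in $X$. The forwards completion $\hat X$ is the set of equivalence classes of forwards admissible sequences in $X$, with $\hat d([\xi],[\eta])=\inf\{c(\xi',\eta')\mid \xi'\sim\xi,\ \eta'\sim\eta\}$, and $\iota(x)$ is the class of the constant sequence at $x$. (Under the hypotheses of the claim, $\hat d$ is an asymmetric metric and $\iota$ is an isometric embedding.) *)

(* Defs.v *)
From HB Require Import structures.
From mathcomp Require Import all_boot all_order all_algebra.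
From mathcomp Require Import all_classical all_reals all_analysis.

Set Implicit Arguments.
Unset Strict Implicit.
Unset Printing Implicit Defensive.

Import Order.TTheory GRing.Theory Num.Theory.
Import numFieldNormedType.Exports.

Local Open Scope classical_set_scope.
Local Open Scope ereal_scope.

(* Limits of distances are taken in \bar R, so that a distance may be, or
   converge to, +oo; sequences are indexed from 0. *)

Record asymmetric_metric (R : realType) (X : Type) (d : X -> X -> \bar R) :
    Prop := AsymmetricMetric {
  adist_ge0 : forall x y, 0 <= d x y ;
  adist_refl : forall x, d x x = 0 ;
  adist_sep : forall x y, d x y = 0 -> d y x = 0 -> x = y ;
  adist_triangle : forall x y z, d x z <= d x y + d y z }.

Definition adist_isometry (R : realType) (X : Type) (d : X -> X -> \bar R)
    (f : X -> X) : Prop :=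
  bijective f /\ forall x y, d (f x) (f y) = d x y.

Section AsymmetricDistance.
Context (R : realType) (X : Type) (d : X -> X -> \bar R).
Implicit Types (x y : X) (xi eta : nat -> X).

Definition closest_forward_limit xi x : Prop :=
  d (xi m) x @[m --> \oo] --> 0 /\
  forall y, d (xi m) y @[m --> \oo] --> 0 -> d x y = 0.

Definition closest_backward_limit xi x : Prop :=
  d x (xi m) @[m --> \oo] --> 0 /\
  forall y, d y (xi m) @[m --> \oo] --> 0 -> d y x = 0.

Definition forwards_admissible xi : Prop :=
  forall e : R, (0 < e)%R ->
  exists N : nat, forall m : nat, (N < m)%N ->
  exists2 K : nat, (m < K)%N &
    forall k : nat, (K < k)%N -> d (xi m) (xi k) < e%:E.

Definition backwards_admissible xi : Prop :=
  forall e : R, (0 < e)%R ->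
  exists N : nat, forall m : nat, (N < m)%N ->
  exists2 K : nat, (m < K)%N &
    forall k : nat, (K < k)%N -> d (xi k) (xi m) < e%:E.

Definition forwards_continuous : Prop :=
  forall xi x, forwards_admissible xi -> closest_forward_limit xi x ->
  forall y, d (xi m) y @[m --> \oo] --> d x y /\
            d y (xi m) @[m --> \oo] --> d y x.

Definition forward_limits_are_backward : Prop :=
  forall xi x, forwards_admissible xi -> closest_forward_limit xi x ->
  backwards_admissible xi /\ closest_backward_limit xi x.

(* For an asymmetric metric d, both limits exist in \bar R whenever xi and eta
   are forwards admissible. *)
Definition limit_dist xi eta : \bar R :=
  limn (fun m => limn (fun k => d (xi m) (eta k))).

Definition interlace xi eta : nat -> X :=
  fun n => if odd n then eta n./2 else xi n./2.

Definition neighbors xi eta : Prop := forwards_admissible (interlace xi eta).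

Definition equivalent_seq xi eta : Prop :=
  neighbors xi eta \/
  exists x, closest_forward_limit xi x /\ closest_forward_limit eta x.

Definition seq_class xi : set (nat -> X) :=
  [set eta | forwards_admissible eta /\ equivalent_seq xi eta].

Definition forwards_completion : Type :=
  {A : set (nat -> X) | exists2 xi, forwards_admissible xi & A = seq_class xi}.

Definition completion_dist (a b : forwards_completion) : \bar R :=
  ereal_inf [set limit_dist xi eta | xi in sval a & eta in sval b].

Lemma forwards_admissible_cst (dM : asymmetric_metric d) x :
   forwards_admissible (fun=> x).
Proof.
move=> e e0; exists 0%N => m _; exists m.+1 => // k _.
by rewrite (adist_refl dM) lte_fin.
Qed.

Definition completion_embedding (dM : asymmetric_metric d) x :
    forwards_completion :=
  exist _ (seq_class (fun=> x))
    (ex_intro2 _ _ (fun=> x) (forwards_admissible_cst dM x) erefl).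

End AsymmetricDistance.

(* Main.v *)
Require Import Defs.
From HB Require Import structures.
From mathcomp Require Import all_boot all_order all_algebra.
From mathcomp Require Import all_classical all_reals all_analysis.

(* Under forward continuity a sequence xi with closest forward limit x satisfies
   both d (xi m) x --> 0 and d x (xi m) --> 0, so it is a neighbor of the
   constant sequence x. Hence equivalence of admissible sequences reduces to
   being neighbors, i.e. to the vanishing of the limit distance c in both
   directions; by the triangle inequality for c, the completion distance of two
   classes is c of any representatives, and it separates classes. An isometry f
   acts on classes by composition. Conversely, for a the class of xi,
   dhat (iota (xi m)) b --> dhat a b for all b; thus an isometric extension F
   of f satisfies dhat a c = dhat a' (F c) for all c, where a' is the class of
   f \o xi, and taking c = a and c = F^-1 a' yields F a = a'. *)

Set Implicit Arguments.
Unset Strict Implicit.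
Unset Printing Implicit Defensive.

Import Order.TTheory GRing.Theory Num.Theory.
Import numFieldNormedType.Exports.

Local Open Scope classical_set_scope.
Local Open Scope ereal_scope.

(** * Convergence of sequences of extended reals *)

Section EReal_sequences.
Context (R : realType).
Implicit Types (u v w : nat -> \bar R) (a b c l x : \bar R).

Lemma limn_einf_ge u x : (\forall k \near \oo, x <= u k) -> x <= limn_einf u.
Proof.
move=> [N _ xu]; rewrite limn_einf_lim.
apply: lime_ge; first exact: is_cvg_einfs.
near=> n; apply: le_ereal_inf_tmp => _ [k /= nk <-].
apply: xu => /=; apply: leq_trans nk.
by near: n; exact: nbhs_infty_ge.
Unshelve. all: by end_near. Qed.

Lemma limn_esup_le u x : (\forall k \near \oo, u k <= x) -> limn_esup u <= x.
Proof.
move=> [N _ xu]; rewrite limn_esup_lim.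
apply: lime_le; first exact: is_cvg_esups.
near=> n; apply: ge_ereal_sup => _ [k /= nk <-].
apply: xu => /=; apply: leq_trans nk.
by near: n; exact: nbhs_infty_ge.
Unshelve. all: by end_near. Qed.

Lemma is_cvgn_limn_einf_sup u : limn_esup u <= limn_einf u -> cvgn u.
Proof.
move=> ul; have eul : limn_esup u = limn_einf u.
  by apply/eqP; rewrite eq_le ul limn_einf_sup.
apply/cvg_ex; exists (limn_einf u).
apply: (@squeeze_cvge _ _ _ _ (einfs u) u (esups u)).
- apply: nearW => n; apply/andP; split.
    by apply: ereal_inf_lbound; exists n => /=.
  by apply: ereal_sup_ubound; exists n => /=.
- by rewrite limn_einf_lim; exact: is_cvg_einfs.
- by rewrite -eul limn_esup_lim; exact: is_cvg_esups.
Qed.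

(** Fixing [m] and passing to the lower limit in [k] gives [u m <= limn_einf u + e] for all large
    [m], so the upper limit exceeds the lower one by at most [e]. *)
Lemma almost_nondecreasing_is_cvgn u :
  (forall e : R, (0 < e)%R ->
    \forall m \near \oo, \forall k \near \oo, u m <= u k + e%:E) ->
  cvgn u.
Proof.
move=> ue; apply: is_cvgn_limn_einf_sup; apply/lee_addgt0Pr => e e0.
apply: limn_esup_le; apply: filterS (ue _ e0) => m ume.
rewrite -leeBlDr//; apply: limn_einf_ge; apply: filterS ume => k.
by rewrite leeBlDr.
Qed.

Lemma almost_nonincreasing_is_cvgn u :
  (forall e : R, (0 < e)%R ->
    \forall m \near \oo, \forall k \near \oo, u k <= u m + e%:E) ->
  cvgn u.
Proof.
move=> ue; apply: is_cvgn_limn_einf_sup; apply/lee_addgt0Pr => e e0.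
rewrite -leeBlDr//; apply: limn_einf_ge.
apply: filterS (ue _ e0) => m ume.
by rewrite leeBlDr//; apply: limn_esup_le.
Qed.

Lemma cvge_near_lt u l x :
  u @ \oo --> l -> l < x -> \forall n \near \oo, u n < x.
Proof.
move=> ul lx; apply: (ul [set y | y < x]).
by apply: open_nbhs_nbhs; split => //; exact: open_ereal_lt_ereal.
Qed.

Lemma ge0_cvge0P u : (forall n, 0 <= u n) ->
  u @ \oo --> 0 <->
  (forall e : R, (0 < e)%R -> \forall n \near \oo, u n < e%:E).
Proof.
move=> u0; split => [ul e e0|ue]; first by apply: cvge_near_lt ul _.
have cu : cvgn u.
  apply: almost_nonincreasing_is_cvgn => e e0; apply: nearW => m.
  by apply: filterS (ue e e0) => k /ltW/le_trans -> //; rewrite leeDr.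
suff <- : limn u = 0 by [].
apply/eqP; rewrite eq_le lime_ge// ?andbT; last exact: nearW.
apply/lee_addgt0Pr => e e0; rewrite add0e.
by apply: lime_le => //; apply: filterS (ue _ e0) => n /ltW.
Qed.

(** Nonnegativity passes to [b] and [c], so [b + c] is never of the form [+oo - oo] and the sum of
    the limits is the limit of the sums. *)
Lemma ge0_cvge_leD u v w a b c : (forall n, 0 <= v n) -> (forall n, 0 <= w n) ->
  u @ \oo --> a -> v @ \oo --> b -> w @ \oo --> c ->
  (forall n, u n <= v n + w n) -> a <= b + c.
Proof.
move=> v0 w0 ua vb wc uvw.
have vwbc : v \+ w @ \oo --> b + c.
  apply: cvgeD => //; apply: ge0_adde_def; rewrite inE.
    by apply: cvge_ge vb; apply: nearW.
  by apply: cvge_ge wc; apply: nearW.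
rewrite -(cvg_lim _ ua)// -(cvg_lim _ vwbc)//.
apply: lee_lim; [exact: cvgP ua|exact: cvgP vwbc|exact: nearW].
Qed.

End EReal_sequences.

(** * Iterated limits of distances along admissible sequences *)

Section Limit_distance.
Context (R : realType) (X : Type) (d : X -> X -> \bar R).
Implicit Types (x y : X) (xi eta zeta : nat -> X).

(** On the diagonal this is admissibility; for two admissible sequences in an asymmetric metric it
    amounts to [limit_dist d xi eta = 0]. *)
Definition asymptotic xi eta : Prop :=
  forall e : R, (0 < e)%R ->
  \forall m \near \oo, \forall k \near \oo, d (xi m) (eta k) < e%:E.

Lemma forwards_admissibleP xi : forwards_admissible d xi <-> asymptotic xi xi.
Proof.
split=> xia e /xia[N].
  move=> Nxi; exists N.+1 => // m /Nxi[K _ mK].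
  by exists K.+1.
move=> _ Nxi; exists N => m /ltnW/Nxi[K _ mK].
(* The maximum enforces the clause [m < K], which the filter form does not record. *)
exists (maxn m.+1 K); first by rewrite leq_maxl.
by move=> k Kk; apply: mK => /=; rewrite (leq_trans _ (ltnW Kk))// leq_maxr.
Qed.

Lemma near_interlace (P : X -> Prop) xi eta :
  (\forall n \near \oo, P (interlace xi eta n)) <->
  (\forall n \near \oo, P (xi n)) /\ (\forall n \near \oo, P (eta n)).
Proof.
split=> [[N _ NP]|[[N _ NP] [M _ MP]]].
  split; exists N => // n /= Nn.
    have := NP n.*2; rewrite /interlace odd_double doubleK; apply => /=.
    by rewrite (leq_trans Nn)// -addnn leq_addr.
  have := NP n.*2.+1; rewrite /interlace /= odd_double uphalf_double.
  apply => /=.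
  by rewrite (leq_trans Nn)// -addnn -addSn leq_addl.
exists (maxn N M).*2 => // n /= NMn.
have {}NMn : (maxn N M <= n./2)%N by rewrite -[maxn _ _]doubleK half_leq.
rewrite /interlace; case: ifPn => _.
  by apply: MP => /=; apply: leq_trans NMn; exact: leq_maxr.
by apply: NP => /=; apply: leq_trans NMn; exact: leq_maxl.
Qed.

(** Admissibility of the interlaced sequence involves two indices; splitting each by parity produces
    the four combinations. *)
Lemma neighborsP xi eta : neighbors d xi eta <->
  [/\ asymptotic xi xi, asymptotic xi eta, asymptotic eta xi
    & asymptotic eta eta].
Proof.
rewrite /neighbors forwards_admissibleP; split=> [xe|[xx xe ex ee] e e0].
  have h e (e0 : (0 < e)%R) := near_interlace
    (fun x => \forall k \near \oo, d x (interlace xi eta k) < e%:E) xi eta.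
  split=> e e0; have [/h -/(_ e0)[h1 h2] _] := (xe e e0, tt).
  - by apply: filterS h1 => m /(near_interlace (fun y => d _ y < e%:E))[].
  - by apply: filterS h1 => m /(near_interlace (fun y => d _ y < e%:E))[].
  - by apply: filterS h2 => m /(near_interlace (fun y => d _ y < e%:E))[].
  - by apply: filterS h2 => m /(near_interlace (fun y => d _ y < e%:E))[].
apply/(near_interlace
  (fun x => \forall k \near \oo, d x (interlace xi eta k) < e%:E)); split.
  apply: filterS2 (xx e e0) (xe e e0) => m ? ?.
  exact/(near_interlace (fun y => d _ y < e%:E)).
apply: filterS2 (ex e e0) (ee e e0) => m ? ?.
exact/(near_interlace (fun y => d _ y < e%:E)).
Qed.

Hypothesis dM : asymmetric_metric d.
Let d0 := adist_ge0 dM.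
Let dt := adist_triangle dM.

Lemma asymptotic_trans xi eta zeta :
  asymptotic xi eta -> asymptotic eta zeta -> asymptotic xi zeta.
Proof.
move=> xe ez e e0; have e20 : (0 < e / 2)%R by rewrite divr_gt0.
apply: filterS (xe _ e20) => m xme.
(* The intermediate index [j] may depend on [m], but is fixed before [k] tends to infinity. *)
have [j [xj]] := filter_ex (filterI xme (ez _ e20)).
apply: filterS => k jk; apply: le_lt_trans (dt _ (eta j) _) _.
by rewrite (splitr e) EFinD lteD.
Qed.

(** By [d (xi m) y <= d (xi m) (xi k) + d (xi k) y], distances from an admissible sequence almost
    increase; distances to it almost decrease. *)
Lemma is_cvgn_adist_to xi y :
  asymptotic xi xi -> cvgn (fun m => d (xi m) y).
Proof.
move=> xx; apply: almost_nondecreasing_is_cvgn => e /xx.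
apply: filterS => m; apply: filterS => k mk.
by rewrite (le_trans (dt _ (xi k) _))// addeC leeD2l// ltW.
Qed.

Lemma is_cvgn_adist_from xi y :
  asymptotic xi xi -> cvgn (fun k => d y (xi k)).
Proof.
move=> xx; apply: almost_nonincreasing_is_cvgn => e /xx.
apply: filterS => m; apply: filterS => k mk.
by rewrite (le_trans (dt _ (xi m) _))// leeD2l// ltW.
Qed.

Lemma limn_adist_ge0 eta x : asymptotic eta eta ->
  0 <= limn (fun k => d x (eta k)).
Proof.
by move=> ee; apply: lime_ge; [exact: is_cvgn_adist_from|exact: nearW].
Qed.

Lemma limn_adist_triangle eta x y : asymptotic eta eta ->
  limn (fun k => d x (eta k)) <= d x y + limn (fun k => d y (eta k)).
Proof.
move=> ee; apply: (@ge0_cvge_leD _ (fun k => d x (eta k)) (fun=> d x y)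
  (fun k => d y (eta k))) => //.
- exact: is_cvgn_adist_from.
- exact: cvg_cst.
- exact: is_cvgn_adist_from.
Qed.

Lemma is_cvgn_limit_dist xi eta : asymptotic xi xi -> asymptotic eta eta ->
  cvgn (fun m => limn (fun k => d (xi m) (eta k))).
Proof.
move=> xx ee; apply: almost_nondecreasing_is_cvgn => e /xx.
apply: filterS => m; apply: filterS => k mk.
by rewrite (le_trans (limn_adist_triangle _ (xi k) _))// addeC leeD2l// ltW.
Qed.

(** Limits are taken from the inside out: along [zeta], then along [eta] (both in [h]), and finally
    along [xi]. *)
Lemma limit_dist_triangle xi eta zeta :
  asymptotic xi xi -> asymptotic eta eta -> asymptotic zeta zeta ->
  limit_dist d xi zeta <= limit_dist d xi eta + limit_dist d eta zeta.
Proof.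
move=> xx ee zz.
have h x : limn (fun k => d x (zeta k)) <=
           limn (fun k => d x (eta k)) + limit_dist d eta zeta.
  apply: (@ge0_cvge_leD _ (fun=> limn (fun k => d x (zeta k)))
    (fun j => d x (eta j)) (fun j => limn (fun k => d (eta j) (zeta k)))) => //.
  - by move=> n; exact: limn_adist_ge0.
  - exact: cvg_cst.
  - exact: is_cvgn_adist_from.
  - exact: is_cvgn_limit_dist.
  - by move=> n; exact: limn_adist_triangle.
apply: (@ge0_cvge_leD _ (fun m => limn (fun k => d (xi m) (zeta k)))
  (fun m => limn (fun k => d (xi m) (eta k))) (fun=> limit_dist d eta zeta)).
- by move=> n; exact: limn_adist_ge0.
- move=> _; apply: lime_ge; first exact: is_cvgn_limit_dist.
  by apply: nearW => n; exact: limn_adist_ge0.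
- exact: is_cvgn_limit_dist.
- exact: is_cvgn_limit_dist.
- exact: cvg_cst.
- by move=> n; exact: h.
Qed.

Lemma limit_dist_eq0 xi eta : asymptotic xi xi -> asymptotic eta eta ->
  limit_dist d xi eta = 0 <-> asymptotic xi eta.
Proof.
move=> xx ee.
have L0 m : 0 <= limn (fun k => d (xi m) (eta k)) by exact: limn_adist_ge0.
have cL := is_cvgn_limit_dist xx ee.
split=> [c0 e e0|xe].
  have /(ge0_cvge0P L0)/(_ e e0) :
    limn (fun k => d (xi m) (eta k)) @[m --> \oo] --> 0.
    by rewrite -c0; exact: cL.
  apply: filterS => m; apply: cvge_near_lt.
  exact: is_cvgn_adist_from.
apply: cvg_lim => //; apply/(ge0_cvge0P L0) => e e0.
(* A strict bound weakens to a large one in the inner limit; halving [e] restores strictness. *)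
have e20 : (0 < e / 2)%R by rewrite divr_gt0.
apply: filterS (xe _ e20) => m xm.
apply: (@le_lt_trans _ _ (e / 2)%:E).
  apply: lime_le; first exact: is_cvgn_adist_from.
  by apply: filterS xm => k /ltW.
by rewrite lte_fin ltr_pdivrMr// ltr_pMr// ltr1n.
Qed.

(** Two triangle inequalities insert the other pair of sequences, and the two extra terms vanish
    between neighbors; symmetry gives the converse bound. *)
Lemma eq_limit_dist xi xi' eta eta' :
  neighbors d xi xi' -> neighbors d eta eta' ->
  limit_dist d xi' eta' = limit_dist d xi eta.
Proof.
suff le a a' b b' : neighbors d a a' -> neighbors d b b' ->
    limit_dist d a' b' <= limit_dist d a b.
  move=> xx' ee'; apply/eqP; rewrite eq_le !le//.
    by apply/neighborsP; have /neighborsP[] := xx'; split.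
  by apply/neighborsP; have /neighborsP[] := ee'; split.
move=> /neighborsP[aa _ a'a a'a'] /neighborsP[bb bb' _ b'b'].
rewrite (le_trans (limit_dist_triangle a'a' aa b'b'))//.
rewrite ((limit_dist_eq0 a'a' aa).2 a'a) add0e.
rewrite (le_trans (limit_dist_triangle aa bb b'b'))//.
by rewrite ((limit_dist_eq0 bb b'b').2 bb') adde0.
Qed.

End Limit_distance.

(** * Classes of admissible sequences and the distance between them *)

Section Completion.
Context (R : realType) (X : Type) (d : X -> X -> \bar R).
Hypotheses (dM : asymmetric_metric d) (dC : forwards_continuous d).
Implicit Types (x y : X) (xi eta : nat -> X) (a b : forwards_completion d).

Lemma neighbors_refl xi : forwards_admissible d xi -> neighbors d xi xi.
Proof. by move=> /forwards_admissibleP xx; apply/neighborsP. Qed.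

Lemma neighbors_sym xi eta : neighbors d xi eta -> neighbors d eta xi.
Proof. by move=> /neighborsP[*]; apply/neighborsP; split. Qed.

Lemma neighbors_trans xi eta zeta :
  neighbors d xi eta -> neighbors d eta zeta -> neighbors d xi zeta.
Proof.
move=> /neighborsP[xx xe ex ee] /neighborsP[_ ez ze zz].
apply/neighborsP; split=> //.
  exact: asymptotic_trans xe ez.
exact: asymptotic_trans ze ex.
Qed.

Lemma neighbors_admissible xi eta :
  neighbors d xi eta -> forwards_admissible d xi /\ forwards_admissible d eta.
Proof. by move=> /neighborsP[? _ _ ?]; split; apply/forwards_admissibleP. Qed.

(* Forward continuity at [y := x] gives [d x (xi m) --> d x x = 0], so that a
   closest forward limit is also approached in the backward direction. *)
Lemma closest_forward_limit_neighbors xi x : forwards_admissible d xi ->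
  closest_forward_limit d xi x -> neighbors d xi (fun=> x).
Proof.
move=> xi_adm xi_x; have [] := dC xi_adm xi_x x.
rewrite (adist_refl dM) => xix xxi.
apply/neighborsP; split;
  last exact/forwards_admissibleP/forwards_admissible_cst.
- exact/forwards_admissibleP.
- move=> e e0.
  have /ge0_cvge0P/(_ e e0) := xix; move=> /(_ (fun=> adist_ge0 dM _ _)).
  by apply: filterS => m ?; apply: nearW.
- move=> e e0; apply: nearW => _.
  by have /ge0_cvge0P/(_ e e0) := xxi; apply=> n; exact: adist_ge0.
Qed.

(** Two sequences with a common closest forward limit are both neighbors of the constant sequence at
    that limit, hence of each other. *)
Lemma mem_seq_class xi eta : forwards_admissible d xi ->
  seq_class d xi eta <-> neighbors d xi eta.
Proof.
move=> xi_adm; split=> [[eta_adm [//|[x [xix ex]]]]|xe].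
  apply: neighbors_trans (closest_forward_limit_neighbors xi_adm xix) _.
  exact/neighbors_sym/closest_forward_limit_neighbors.
by split; [exact: (neighbors_admissible xe).2|left].
Qed.

Lemma seq_class_neighbors xi eta :
  neighbors d xi eta -> seq_class d xi = seq_class d eta.
Proof.
move=> xe; have [x_adm e_adm] := neighbors_admissible xe.
rewrite predeqE => zeta; rewrite !mem_seq_class//.
split; apply: neighbors_trans => //.
exact: neighbors_sym.
Qed.

Lemma completion_inj a b : sval a = sval b -> a = b.
Proof. by case: a b => [A PA] [B PB] /= AB; exact: eq_exist. Qed.

(** The infimum runs over a single value, since [limit_dist] does not change when its arguments are
    replaced by neighbors. *)
Lemma completion_dist_class a b xi eta :
  forwards_admissible d xi -> forwards_admissible d eta ->
  sval a = seq_class d xi -> sval b = seq_class d eta ->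
  completion_dist a b = limit_dist d xi eta.
Proof.
move=> x_adm e_adm axi beta; rewrite /completion_dist axi beta.
rewrite [X in ereal_inf X](_ : _ = [set limit_dist d xi eta]) ?ereal_inf1//.
rewrite eqEsubset; split=> [_ [xi' xi'P [eta' eta'P <-]]|_ ->].
  rewrite /= (@eq_limit_dist _ _ _ dM xi xi' eta eta')//; exact/mem_seq_class.
exists xi; first by apply/mem_seq_class => //; exact: neighbors_refl.
by exists eta => //; apply/mem_seq_class => //; exact: neighbors_refl.
Qed.

Lemma completion_dist_sep a b :
  completion_dist a b = 0 -> completion_dist b a = 0 -> a = b.
Proof.
have [xi x_adm axi] := svalP a; have [eta e_adm beta] := svalP b.
rewrite (completion_dist_class x_adm e_adm axi beta).
rewrite (completion_dist_class e_adm x_adm beta axi).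
have [/forwards_admissibleP xx /forwards_admissibleP ee] := (x_adm, e_adm).
move=> /(limit_dist_eq0 dM xx ee) xe /(limit_dist_eq0 dM ee xx) ex.
apply: completion_inj; rewrite axi beta; apply: seq_class_neighbors.
exact/neighborsP.
Qed.

Lemma completion_distxx a : completion_dist a a = 0.
Proof.
have [xi x_adm axi] := svalP a.
rewrite (completion_dist_class x_adm x_adm axi axi).
by have /forwards_admissibleP xx := x_adm; exact/limit_dist_eq0.
Qed.

Lemma cvg_completion_dist_embedding a b xi :
  forwards_admissible d xi -> sval a = seq_class d xi ->
  completion_dist (completion_embedding dM (xi m)) b @[m --> \oo] -->
    completion_dist a b.
Proof.
move=> x_adm axi; have [eta e_adm beta] := svalP b.
rewrite (completion_dist_class x_adm e_adm axi beta).
have /= E m := @completion_dist_class (completion_embedding dM (xi m)) b _ _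
  (forwards_admissible_cst dM (xi m)) e_adm erefl beta.
(* For a constant first sequence only the inner limit along [eta] survives, so what remains is the
   outer limit defining [limit_dist d xi eta]. *)
under eq_fun do rewrite E /limit_dist lim_cst//.
have [/forwards_admissibleP xx /forwards_admissibleP ee] := (x_adm, e_adm).
exact: is_cvgn_limit_dist.
Qed.

Lemma isometry_extension_unique (f : X -> X)
    (F : forwards_completion d -> forwards_completion d) a b xi :
  adist_isometry (@completion_dist R X d) F ->
  F \o completion_embedding dM = completion_embedding dM \o f ->
  forwards_admissible d xi -> forwards_admissible d (f \o xi) ->
  sval a = seq_class d xi -> sval b = seq_class d (f \o xi) -> F a = b.
Proof.
move=> [[G FK GK] Fd] Ff x_adm fx_adm axi bfxi.
have E c : completion_dist a c = completion_dist b (F c).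
  have ac := @cvg_completion_dist_embedding _ c _ x_adm axi.
  have := @cvg_completion_dist_embedding _ (F c) _ fx_adm bfxi.
  have -> :
      (fun m => completion_dist (completion_embedding dM ((f \o xi) m)) (F c)) =
      (fun m => completion_dist (completion_embedding dM (xi m)) c).
    apply/funext => m; rewrite -[RHS]Fd; congr completion_dist.
    by have /(congr1 (@^~ (xi m))) /= -> := Ff.
  by move=> bc; apply: cvg_unique ac bc.
(* As [E] controls only distances out of [a] and [b], the distance from [F a] to [b] requires
   writing [b] as [F (G b)], by surjectivity of [F]. *)
apply: completion_dist_sep; last by rewrite -E completion_distxx.
by rewrite -{1}[b]GK Fd E GK completion_distxx.
Qed.

End Completion.

(** * The action of an isometry on classes *)

Section Extension.
Context (R : realType) (X : Type) (d : X -> X -> \bar R).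
Implicit Types (f g : X -> X) (xi eta : nat -> X).

Lemma closest_forward_limit_isometry f xi x : adist_isometry d f ->
  closest_forward_limit d xi x -> closest_forward_limit d (f \o xi) (f x).
Proof.
move=> [[g fK gK] fd] [xix xmin]; split=> [|y].
  by under eq_fun do rewrite /= fd.
(* A competitor [y] is [f (g y)], so the minimality of [x] can be applied to [g y]. *)
rewrite -{1}[y]gK; under eq_fun do rewrite /= fd.
by move=> /xmin; rewrite -fd gK.
Qed.

Lemma forwards_admissible_isometry f xi : adist_isometry d f ->
  forwards_admissible d xi -> forwards_admissible d (f \o xi).
Proof.
move=> [_ fd] xia e /xia[N NP]; exists N => m /NP[K mK KP].
by exists K => // k /KP; rewrite /= fd.
Qed.

Lemma seq_class_isometry f xi eta : adist_isometry d f ->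
  seq_class d xi eta -> seq_class d (f \o xi) (f \o eta).
Proof.
move=> f_iso [e_adm xe]; split; first exact: forwards_admissible_isometry.
case: xe => [xe|[x [xix ex]]]; [left|right].
  rewrite /neighbors (_ : interlace _ _ = f \o interlace xi eta).
    exact: forwards_admissible_isometry.
  by apply/funext => n; rewrite /interlace /=; case: ifP.
by exists (f x); split; exact: closest_forward_limit_isometry.
Qed.

Lemma adist_isometry_inv f g : adist_isometry d f ->
  cancel f g -> cancel g f -> adist_isometry d g.
Proof.
by move=> [_ fd] fK gK; split=> [|x y]; [exists f|rewrite -fd !gK].
Qed.

Lemma image_seq_class f xi : adist_isometry d f ->
  comp f @` seq_class d xi = seq_class d (f \o xi).
Proof.
move=> f_iso; have [[g fK gK] _] := f_iso.
rewrite eqEsubset; split=> [_ [eta xe <-]|eta xe].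
  exact: seq_class_isometry.
(* The reverse inclusion is the preservation of equivalence by the inverse isometry [g]. *)
exists (g \o eta); last by apply/funext => n /=; rewrite gK.
rewrite (_ : xi = g \o (f \o xi)).
  exact/seq_class_isometry/xe/(adist_isometry_inv f_iso).
by apply/funext => n /=; rewrite fK.
Qed.

Lemma completion_map_subproof f (f_iso : adist_isometry d f)
    (a : forwards_completion d) :
  exists2 xi, forwards_admissible d xi & comp f @` sval a = seq_class d xi.
Proof.
have [xi x_adm axi] := svalP a; exists (f \o xi).
  exact: forwards_admissible_isometry.
by rewrite axi image_seq_class.
Qed.

(** Taking the direct image of the whole class avoids any choice of representative, and inverses
    follow from functoriality of images. *)
Definition completion_map f (f_iso : adist_isometry d f)
    (a : forwards_completion d) : forwards_completion d :=
  exist _ (comp f @` sval a) (completion_map_subproof f_iso a).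

Lemma completion_mapK f g (f_iso : adist_isometry d f)
    (g_iso : adist_isometry d g) :
  cancel f g -> cancel (completion_map f_iso) (completion_map g_iso).
Proof.
move=> fK a; apply: completion_inj => /=; rewrite image_comp.
rewrite -[RHS]image_id; apply: eq_imagel => xi _ /=.
by apply/funext => n /=; rewrite fK.
Qed.

Lemma completion_map_isometry f (f_iso : adist_isometry d f) :
  adist_isometry (@completion_dist R X d) (completion_map f_iso).
Proof.
have [[g fK gK] fd] := f_iso.
have g_iso := adist_isometry_inv f_iso fK gK.
split=> [|a b]; first by exists (completion_map g_iso); exact: completion_mapK.
have fE xi eta : limit_dist d (f \o xi) (f \o eta) = limit_dist d xi eta.
  by rewrite /limit_dist; under eq_fun do under eq_fun do rewrite /= fd.
(* Composition with [f] preserves [limit_dist], so both infima range over the same set of values. *)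
rewrite /completion_dist /=; congr ereal_inf.
rewrite eqEsubset.
split=> [_ [_ [xi axi <-] [_ [eta beta <-] <-]]|_ [xi axi [eta beta <-]]].
  by exists xi => //; exists eta => //; rewrite fE.
exists (f \o xi); first by exists xi.
by exists (f \o eta); [exists eta|rewrite fE].
Qed.

Lemma completion_map_embedding f (f_iso : adist_isometry d f)
    (dM : asymmetric_metric d) :
  completion_map f_iso \o completion_embedding dM =
  completion_embedding dM \o f.
Proof.
by apply/funext => x; apply: completion_inj; rewrite /= image_seq_class.
Qed.

End Extension.

Theorem corollary2 (R : realType) (X : Type) (d : X -> X -> \bar R)
    (dM : asymmetric_metric d)
    (dC : forwards_continuous d)
    (dS : forward_limits_are_backward d)
    (f : X -> X) (f_iso : adist_isometry d f) :
  exists! F : forwards_completion d -> forwards_completion d,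
    adist_isometry (@completion_dist R X d) F /\
    F \o completion_embedding dM = completion_embedding dM \o f.
Proof.
exists (completion_map f_iso); split.
  split; first exact: completion_map_isometry.
  exact: completion_map_embedding.
move=> F [F_iso Ff]; apply/funext => a; have [xi x_adm axi] := svalP a.
apply/esym; apply: (isometry_extension_unique dC F_iso Ff x_adm) => //.
  exact: forwards_admissible_isometry.
by rewrite /= axi image_seq_class.
Qed.
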